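(* Let $n\ge 3$. Let $\pi_0=\mathbf 1,\pi_1,\dots,\pi_{n!-1}$ be a genlex Hamiltonian listing of $S_n$, started at the identity, using $n-1$ generators (i.e. the set $\{\pi_i^{-1}\pi_{i+1}:0\le i<n!-1\}$ has exactly $n-1$ elements), and let $g_n$ be its generator lying in $G_n\setminus G_{n-1}$. Then the listing ends at $\pi_{n!-1}=g_n^{-1}$, and appending the single letter $g_n$ closes it into a Hamiltonian cycle.
   Context: $S_n$ is the group of permutations of $\{1,\dots,n\}$, with one-line notation $\pi=\pi_1\cdots\pi_n$. Operations act on positions, on the right: $(\pi g)_i=\pi_{g(i)}$, i.e. $\pi g$ is the composition $i\mapsto\pi(g(i))$. For $1\le k\le n$, $G_k=\mathrm{Sym}\{1,\dots,k\}$ is the subgroup of permutations fixing each of $k+1,\dots,n$. The sets $G_k\setminus G_{k-1}$, $2\le k\le n$, are called layers; a genlex Hamiltonian listing uses at least one generator from each layer, so one using $n-1$ generators uses exactly one from each. A Hamiltonian listing of $S_n$ is a sequence $\pi_0,\dots,\pi_{n!-1}$ containing each element of $S_n$ exactly once; its generators are the elements $\pi_i^{-1}\pi_{i+1}$. It is genlex when, for every $k$, the permutations agreeing in their last $n-k$ letters are consecutive, equivalently each left coset $\pi G_k$ occupies consecutive positions. Appending the letter $g$ means making one further step $\pi_{n!-1}\mapsto\pi_{n!-1}g$. *)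

(* Defs.v *)
From mathcomp Require Import all_boot all_order all_fingroup.

Set Implicit Arguments.
Unset Strict Implicit.
Unset Printing Implicit Defensive.

Local Open Scope group_scope.

(* The letters and positions 1, ..., n are represented by 0, ..., n-1. *)

(* MathComp multiplies permutations left to right, (s * t) i = t (s i).
   Here operations act on positions, on the right: rmul p g is the
   one-line word i |-> p (g i). *)
Definition rmul n (p g : 'S_n) : 'S_n := g * p.

Lemma rmulE n (p g : 'S_n) i : rmul p g i = p (g i).
Proof. exact: permM. Qed.

Definition G n (k : nat) : {set 'S_n} := Sym [set i : 'I_n | i < k].

Definition layer n (k : nat) : {set 'S_n} := G n k :\: G n k.-1.

Definition hamiltonian_listing n (s : seq 'S_n) : Prop :=
  uniq s /\ forall p : 'S_n, p \in s.

Definition generators n (s : seq 'S_n) : {set 'S_n} :=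
  [set rmul (nth 1 s i)^-1 (nth 1 s i.+1) | i : 'I_(size s).-1].

(* p and q agree in their last n - k letters *)
Definition same_suffix n (k : nat) (p q : 'S_n) : Prop :=
  forall i : 'I_n, k <= i -> p i = q i.

Definition genlex n (s : seq 'S_n) : Prop :=
  forall k, 1 <= k <= n ->
  forall a b c, a <= b <= c -> c < size s ->
    same_suffix k (nth 1 s a) (nth 1 s c) ->
    same_suffix k (nth 1 s a) (nth 1 s b).

Definition append_letter n (s : seq 'S_n) (g : 'S_n) : seq 'S_n :=
  rcons s (rmul (last 1 s) g).

(* A Hamiltonian cycle of the Cayley graph with connection set S, written as
   the closed walk w, whose last vertex repeats the first one. *)
Definition hamiltonian_cycle n (S : {set 'S_n}) (w : seq 'S_n) : Prop :=
  [/\ hamiltonian_listing (take (size w).-1 w),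
      last 1 w = head 1 w &
      generators w \subset S].

(* Main.v *)
Require Import Defs.
From mathcomp Require Import all_boot all_order all_fingroup.
From mathcomp Require Import zify.

(** A listing p_0, p_1, ... of this kind is completely rigid, because its
    steps follow a ruler sequence.  A left coset of G_k has k! elements, and
    in a genlex listing it occupies consecutive positions; hence the cosets of
    G_k are exactly the aligned blocks of length k! ([genlex_blocks]), and the
    step leaving position i lies in G_k if and only if k! does not divide
    i + 1 ([step_in_G]).  So the layer of a step depends only on its position.
    Every one of the n - 1 layers is hit, so with n - 1 generators each layer
    contains a single generator, and the step itself depends only on its
    position ([step_ruler]).

    It follows that all blocks of length (n - 1)! spell the same word: the
    m-th block is the left translate of the initial one by its own starting
    point ([block_translate]).  Let e be the end of the initial block.
    Consecutive blocks are joined by g = g_n, so the m-th block starts at c^m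
    with c = e g ([block_starts]).  These n blocks are distinct cosets of
    G_(n-1), which means that the values c^m(n), 0 <= m < n, are distinct.
    So c is an n-cycle and c^n = 1 ([block_shift_order]).  The listing ends at
    c^(n-1) e = c^n g^-1 = g^-1, from which one more letter g leads back to
    the identity. *)

Set Implicit Arguments.
Unset Strict Implicit.
Unset Printing Implicit Defensive.

Local Open Scope group_scope.

(** * Cosets of the groups G_k *)

Lemma rmulVKE n (p q : 'S_n) : rmul p (rmul p^-1 q) = q.
Proof. by rewrite /rmul mulgKV. Qed.

Lemma mem_GP n k (p : 'S_n) :
  reflect (forall i : 'I_n, k <= i -> p i = i) (p \in G n k).
Proof.
rewrite inE; apply: (iffP subsetP) => [sub i ki | fix_p i].
  by apply/eqP; apply: contraTT ki => /sub; rewrite inE -ltnNge.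
by rewrite !inE ltnNge; apply: contraNN => /fix_p ->.
Qed.

(** Agreement in the last n - k letters is membership in a common left coset
    of G_k: this translates the genlex condition into group theory. *)
Lemma step_in_GP n k (p q : 'S_n) :
  reflect (same_suffix k p q) (rmul p^-1 q \in G n k).
Proof.
apply: (iffP (mem_GP _ _)) => eq_pq i /eq_pq.
  by rewrite rmulE => e; rewrite -{1}e permKV.
by rewrite rmulE => <-; rewrite permK.
Qed.

Lemma same_suffix_sym n k (p q : 'S_n) : same_suffix k p q -> same_suffix k q p.
Proof. by move=> e i /e. Qed.

Lemma same_suffix_trans n k (p q r : 'S_n) :
  same_suffix k p q -> same_suffix k q r -> same_suffix k p r.
Proof. by move=> e f i ki; rewrite e // f. Qed.

Lemma card_G n k : k <= n -> #|G n k| = k`!.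
Proof.
move=> le_kn; rewrite [#|_|](_ : _ = #|perm_on [set i : 'I_n | i < k]|).
  rewrite card_perm; congr _`!.
  rewrite -sum1_card (eq_bigl (fun i : 'I_n => i < k)) => [|i]; last by rewrite inE.
  by rewrite (big_ord_narrow le_kn) sum1_card card_ord.
by apply: eq_card => p; rewrite inE.
Qed.

Lemma size_hamiltonian n (s : seq 'S_n) : hamiltonian_listing s -> size s = n`!.
Proof.
case=> /card_uniqP <- s_all; rewrite -(card_G (leqnn n)).
by apply: eq_card => p; rewrite s_all; apply/esym/mem_GP => i; rewrite leqNgt ltn_ord.
Qed.

Lemma count_coset n (s : seq 'S_n) k (p : 'S_n) :
    hamiltonian_listing s -> k <= n ->
  count (fun q => rmul p^-1 q \in G n k) s = k`!.
Proof.
case=> s_uniq s_all le_kn; rewrite -(card_G le_kn) -size_filter.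
rewrite -(card_uniqP (filter_uniq _ s_uniq)) -(card_rcoset (G n k) p).
apply: eq_card => q; rewrite mem_filter s_all andbT.
by rewrite mem_rcoset.
Qed.

(** * Aligned blocks *)

(** Counting pins down a predicate on positions that is supported on [p, N)
    and closed downwards there: it must be the interval of length c that
    starts at p.  A point beyond p + c would drag in more than c points, and
    a gap before p + c would leave fewer. *)
Lemma interval_count (N p c : nat) (P : pred nat) :
    (forall x, x < p -> ~~ P x) ->
    (forall x y, p <= x <= y -> y < N -> P y -> P x) ->
    count P (iota 0 N) = c ->
  forall x, x < N -> P x = (p <= x < p + c).
Proof.
move=> P_lt P_down cnt x ltxN.
have [ltxp | lepx] := ltnP x p; first by rewrite (negbTE (P_lt x ltxp)).
have cnt_lt : count P (iota 0 p) = 0.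
  apply/eqP; rewrite eqn0Ngt -has_count; apply/hasPn => y.
  by rewrite mem_iota => /andP[_]; apply: P_lt.
have eqN : N = p + ((x - p) + (N - x)) by lia.
move: cnt; rewrite {1}eqN !iotaD !count_cat cnt_lt !add0n subnKC //.
case Px: (P x) => cnt; apply/esym.
  have /eqP : all P (iota p (x - p)).
    apply/allP => y; rewrite mem_iota => /andP[ley lty].
    by apply: (P_down y x) => //; lia.
  rewrite all_count size_iota => /eqP cnt1.
  have : 0 < count P (iota x (N - x)).
    by rewrite -has_count; apply/hasP; exists x => //; rewrite mem_iota; lia.
  by lia.
have cnt2 : count P (iota x (N - x)) = 0.
  apply/eqP; rewrite eqn0Ngt -has_count; apply/hasPn => y.
  rewrite mem_iota => /andP[lexy lty]; apply/negP => Py.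
  by move: (P_down x y); rewrite Px; lia.
have := count_size P (iota p (x - p)); rewrite size_iota; lia.
Qed.

(** The equal-length intervals occupied by the cosets of G_k tile the positions
    from 0 on, so the tiling has to be the aligned one.  The induction runs
    along the tiles: when the earlier ones are complete cosets, position
    m * k! opens a new coset, which then fills the next k! positions. *)
Lemma genlex_blocks n (s : seq 'S_n) k a b :
    hamiltonian_listing s -> genlex s -> 1 <= k <= n ->
    a < size s -> b < size s ->
  (rmul (nth 1 s a)^-1 (nth 1 s b) \in G n k) = (a %/ k`! == b %/ k`!).
Proof.
move=> s_ham s_genlex le1kn lta ltb.
have f_gt0 := fact_gt0 k.
pose rel x y := rmul (nth 1 s x)^-1 (nth 1 s y) \in G n k.
have rel_sym x y : rel x y -> rel y x.
  by move/step_in_GP/same_suffix_sym/step_in_GP.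
have rel_trans x y z : rel x y -> rel y z -> rel x z.
  by move=> /step_in_GP e /step_in_GP /(same_suffix_trans e) /step_in_GP.
have block m x : m * k`! < size s -> x < size s ->
    rel (m * k`!)%N x = (x %/ k`! == m).
  have [M] := ubnP m; elim: M m x => // M IH m x leM ltm ltx.
  have -> : (x %/ k`! == m) = (m * k`! <= x < m * k`! + k`!).
    by rewrite eqn_leq leq_divRL // -ltnS ltn_divLR // mulSn addnC andbC.
  apply: (@interval_count (size s) _ _ (rel (m * k`!)%N)) ltx.
  (* An earlier position y lies in an earlier tile, which is a full coset by
     induction and does not contain m * k!. *)
  - move=> y lty; apply/negP => rel_my.
    have ltm' : y %/ k`! < m by rewrite ltn_divLR.
    have ltM' : y %/ k`! < M by apply: leq_trans ltm' _.
    have ltb' : y %/ k`! * k`! < size s.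
      by apply: leq_ltn_trans (leq_divM _ _) (ltn_trans lty ltm).
    have rel_y : rel (y %/ k`! * k`!)%N y by rewrite IH ?eqxx // (ltn_trans lty).
    have := rel_trans _ _ _ rel_y (rel_sym _ _ rel_my).
    by rewrite IH // mulnK // gtn_eqF.
  - move=> y z le_yz ltz /step_in_GP e; apply/step_in_GP.
    exact: (s_genlex k le1kn _ y z).
  have le_kn : k <= n by case/andP: le1kn.
  rewrite -[RHS](count_coset (nth 1 s (m * k`!)%N) s_ham le_kn).
  by rewrite -[X in _ = count _ X](mkseq_nth 1 s) count_map.
have start x : x < size s -> rel (x %/ k`! * k`!)%N x.
  by move=> ltx; rewrite block ?eqxx // (leq_ltn_trans (leq_divM _ _) ltx).
have ltA : a %/ k`! * k`! < size s := leq_ltn_trans (leq_divM _ _) lta.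
rewrite eq_sym -(block _ b ltA ltb).
apply/idP/idP; first exact: rel_trans (start a lta).
exact: rel_trans (rel_sym _ _ (start a lta)).
Qed.

(** * Steps and their layers *)

Definition step n (s : seq 'S_n) i : 'S_n := rmul (nth 1 s i)^-1 (nth 1 s i.+1).

Lemma nth_step n (s : seq 'S_n) i : nth 1 s i.+1 = rmul (nth 1 s i) (step s i).
Proof. by rewrite rmulVKE. Qed.

Lemma step_generators n (s : seq 'S_n) i :
  i.+1 < size s -> step s i \in generators s.
Proof.
move=> lti; have lti' : i < (size s).-1 by lia.
by apply/imsetP; exists (Ordinal lti').
Qed.

(** Leaving a G_k-coset means crossing the boundary of an aligned block, and
    these boundaries are the multiples of k!. *)
Lemma step_in_G n (s : seq 'S_n) k i :
    hamiltonian_listing s -> genlex s -> 1 <= k <= n -> i.+1 < size s ->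
  (step s i \in G n k) = ~~ (k`! %| i.+1).
Proof.
move=> s_ham s_genlex le1kn lti.
rewrite genlex_blocks //; last exact: ltnW.
by rewrite divnS ?fact_gt0 //; case: (_ %| _) => /=; lia.
Qed.

Lemma layer_inj n j k (h : 'S_n) :
  h \in layer n j -> h \in layer n k -> j = k.
Proof.
have mono a b : a <= b -> h \in G n a -> h \in G n b.
  by move=> le_ab /mem_GP fix_h; apply/mem_GP => i /(leq_trans le_ab)/fix_h.
rewrite !in_setD => /andP[Njm jm] /andP[Nkm km].
case: (ltngtP j k) => // lt_jk.
  by case/negP: Nkm; apply: mono jm; lia.
by case/negP: Njm; apply: mono km; lia.
Qed.

(** Layer j + 2 is first entered when the initial block of length (j + 1)! is
    exhausted; this exhibits a generator in each of the n - 1 layers. *)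
Lemma layer_first_step n (s : seq 'S_n) j :
    hamiltonian_listing s -> genlex s -> j < n.-1 ->
  (j.+1)`!.-1.+1 < size s /\ step s (j.+1)`!.-1 \in layer n j.+2.
Proof.
move=> s_ham s_genlex ltj; have f_gt0 := fact_gt0 j.+1.
have lt_f : (j.+1)`! < (j.+2)`! by rewrite [ltnRHS]factS ltn_Pmull.
have lt_size : (j.+1)`! < size s.
  by rewrite size_hamiltonian // (leq_trans lt_f) // leq_fact //; lia.
rewrite prednK //; split=> //.
by rewrite in_setD !step_in_G ?prednK // ?dvdnn ?gtnNdvd //; lia.
Qed.

(** The first steps into the n - 1 layers are pairwise distinct, since layers
    are disjoint; when there are only n - 1 generators they exhaust them. *)
Lemma generatorsE n (s : seq 'S_n) :
    hamiltonian_listing s -> genlex s -> #|generators s| = n.-1 ->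
  generators s = [set step s (j.+1)`!.-1 | j : 'I_n.-1].
Proof.
move=> s_ham s_genlex s_gens; apply/esym/eqP; rewrite eqEcard.
apply/andP; split.
  apply/subsetP => _ /imsetP[j _ ->].
  by apply: step_generators; case: (layer_first_step s_ham s_genlex (ltn_ord j)).
rewrite s_gens card_imset ?card_ord // => i j eq_ij; apply: val_inj.
have [_ Li] := layer_first_step s_ham s_genlex (ltn_ord i).
have [_ Lj] := layer_first_step s_ham s_genlex (ltn_ord j).
by rewrite eq_ij in Li; case: (layer_inj Li Lj).
Qed.

Lemma generator_layer_inj n (s : seq 'S_n) k g h :
    hamiltonian_listing s -> genlex s -> #|generators s| = n.-1 ->
    g \in generators s -> h \in generators s ->
    g \in layer n k -> h \in layer n k ->
  g = h.
Proof.
move=> s_ham s_genlex s_gens; rewrite generatorsE //.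
case/imsetP=> i _ -> /imsetP[j _ ->] Lik Ljk.
have [_ Li] := layer_first_step s_ham s_genlex (ltn_ord i).
have [_ Lj] := layer_first_step s_ham s_genlex (ltn_ord j).
by have [->] : i.+2 = j.+2 by rewrite (layer_inj Li Lik) (layer_inj Lj Ljk).
Qed.

(** The divisibility pattern of the position determines the layer of the step,
    and the layer contains only one generator. *)
Lemma step_ruler n (s : seq 'S_n) a b :
    hamiltonian_listing s -> genlex s -> #|generators s| = n.-1 ->
    a.+1 < size s -> b.+1 < size s ->
    (forall k, 1 <= k <= n -> (k`! %| a.+1) = (k`! %| b.+1)) ->
  step s a = step s b.
Proof.
move=> s_ham s_genlex s_gens lta ltb eq_ab.
have gen_a := step_generators lta.
have [j La] : exists j : 'I_n.-1, step s a \in layer n j.+2.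
  move: gen_a; rewrite generatorsE // => /imsetP[j _ ->]; exists j.
  by case: (layer_first_step s_ham s_genlex (ltn_ord j)).
have ltj := ltn_ord j.
apply: (generator_layer_inj s_ham s_genlex s_gens gen_a _ La).
  exact: step_generators.
by move: La; rewrite !in_setD !step_in_G ?eq_ab //; lia.
Qed.

(** * Translation of the top-level blocks *)

(** The steps at offset i of the m-th and of the initial block agree: adding
    m * n! does not affect divisibility by k! when k <= n, and neither
    position reaches (n + 1)!. *)
Lemma block_translate n (s : seq 'S_n.+1) m i :
    hamiltonian_listing s -> genlex s -> #|generators s| = n ->
    head 1 s = 1 -> m <= n -> i < n`! ->
  nth 1 s (m * n`! + i) = rmul (nth 1 s (m * n`!)) (nth 1 s i).
Proof.
move=> s_ham s_genlex s_gens s1 le_mn.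
have s_size := size_hamiltonian s_ham.
elim: i => [|i IH] lti; first by rewrite addn0 nth0 s1 /rmul mul1g.
have lt_mi : (m * n`! + i).+1 < (n.+1)`!.
  rewrite factS mulSn addnC -addnS -addSn.
  by have := leq_mul le_mn (leqnn n`!); lia.
have lt_i : i.+1 < (n.+1)`! by lia.
rewrite addnS !nth_step IH ?(ltnW lti) //.
rewrite [step s _](@step_ruler _ s _ i) ?s_size //; first by rewrite /rmul mulgA.
move=> k /andP[k_gt0]; rewrite leq_eqVlt => /orP[/eqP-> | ltkn].
  by rewrite !gtnNdvd.
by rewrite -addnS dvdn_addr // dvdn_mull // -(@bin_fact n k ltkn) mulnCA dvdn_mulr.
Qed.

(** The element raised to the power m is the displacement from one block start
    to the next: run through the common block word, then append g. *)
Lemma block_starts n (s : seq 'S_n.+1) g m :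
    hamiltonian_listing s -> genlex s -> #|generators s| = n ->
    head 1 s = 1 -> g \in generators s -> g \in layer n.+1 n.+1 ->
    0 < n -> m <= n ->
  nth 1 s (m * n`!) = (rmul (nth 1 s n`!.-1) g) ^+ m.
Proof.
move=> s_ham s_genlex s_gens s1 g_gen g_layer n_gt0.
have f_gt0 := fact_gt0 n.
elim: m => [|m IH] ltmn; first by rewrite mul0n nth0 s1 expg0.
have eq_pos : (m.+1 * n`! = (m * n`! + n`!.-1).+1)%N.
  by rewrite mulSn -addnS prednK // addnC.
have lt_size : m.+1 * n`! < size s.
  by rewrite size_hamiltonian // factS ltn_pmul2r.
rewrite eq_pos nth_step block_translate ?IH ?ltn_predL // 1?ltnW //.
(* The step between two blocks leaves a G_n-coset, so it is in the top layer
   and must be g. *)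
rewrite (@generator_layer_inj _ s n.+1 (step s _) g) //.
- by rewrite expgS /rmul mulgA.
- by apply: step_generators; rewrite -eq_pos.
rewrite in_setD !step_in_G -?eq_pos ?leqnn ?leqnSn ?n_gt0 //=.
by rewrite dvdn_mull // gtnNdvd ?muln_gt0 // -(size_hamiltonian s_ham).
Qed.

(** The first n iterates of x exhaust the n points, so c^n x is one of them; by
    injectivity of c it can only be x itself, and every other point is an
    iterate of x and is therefore fixed by c^n as well. *)
Lemma expg_full_orbit n (c : 'S_n) (x : 'I_n) :
    (forall i j, i < j < n -> (c ^+ i) x != (c ^+ j) x) ->
  c ^+ n = 1.
Proof.
move=> c_neq.
pose f (m : 'I_n) := (c ^+ m) x.
have f_inj : injective f.
  move=> i j /eqP eq_f; apply/val_inj => /=.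
  case: (ltngtP i j) => // lt_ij.
    by move: eq_f; rewrite /f (negbTE (c_neq _ _ _)) // lt_ij ltn_ord.
  by move: eq_f; rewrite /f eq_sym (negbTE (c_neq _ _ _)) // lt_ij ltn_ord.
have f_onto y : exists m : 'I_n, y = (c ^+ m) x.
  by have [h _ fK] := injF_bij f_inj; exists (h y); rewrite -/(f (h y)) fK.
have c_n : (c ^+ n) x = x.
  have [[m ltm] /= eq_m] := f_onto ((c ^+ n) x).
  have [m0 | m_gt0] := posnP m; first by rewrite eq_m m0 perm1.
  have /negP[] : (c ^+ 0) x != (c ^+ (n - m)) x by apply: c_neq; lia.
  apply/eqP/(@perm_inj _ (c ^+ m)).
  by rewrite -!permM -!expgD add0n subnK ?eq_m // ltnW.
apply/permP => y; have [m ->] := f_onto y.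
by rewrite perm1 -!permM -expgD addnC expgD permM c_n.
Qed.

(** The starts of different blocks lie in different cosets of G_n, that is, they
    take different values at the last position; as they are the powers of the
    displacement, its orbit of the last position is full. *)
Lemma block_shift_order n (s : seq 'S_n.+1) g :
    hamiltonian_listing s -> genlex s -> #|generators s| = n ->
    head 1 s = 1 -> g \in generators s -> g \in layer n.+1 n.+1 -> 0 < n ->
  (rmul (nth 1 s n`!.-1) g) ^+ n.+1 = 1.
Proof.
move=> s_ham s_genlex s_gens s1 g_gen g_layer n_gt0.
apply: (@expg_full_orbit _ _ ord_max) => i j /andP[lt_ij ltj].
have lt_size m : m < n.+1 -> m * n`! < size s.
  by move=> ltm; rewrite size_hamiltonian // factS ltn_pmul2r ?fact_gt0.
have lti := ltn_trans lt_ij ltj.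
apply/eqP => eq_max.
have : rmul (nth 1 s (i * n`!))^-1 (nth 1 s (j * n`!)) \in G n.+1 n.
  apply/step_in_GP => x le_nx; have -> : x = ord_max.
    by apply: val_inj => /=; have := ltn_ord x; lia.
  by rewrite !(@block_starts _ s g).
by rewrite genlex_blocks ?lt_size ?n_gt0 ?leqnSn //= !mulnK ?fact_gt0 // ltn_eqF.
Qed.

Theorem corollary3p4 (n : nat) (s : seq 'S_n) (g : 'S_n)
    (hn : 3 <= n)
    (s_ham : hamiltonian_listing s)
    (s_genlex : genlex s)
    (s_start : head 1 s = 1)
    (s_gens : #|generators s| = n.-1)
    (g_gen : g \in generators s)
    (g_layer : g \in layer n n) :
  last 1 s = g^-1 /\ hamiltonian_cycle (generators s) (append_letter s g).
Proof.
case: n hn s g s_ham s_genlex s_start s_gens g_gen g_layer => // n hn s g.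
move=> s_ham s_genlex s_start s_gens g_gen g_layer.
have n_gt0 : 0 < n by lia.
have f_gt0 := fact_gt0 n.
have s_size := size_hamiltonian s_ham.
have s_gt0 : 0 < size s by rewrite s_size fact_gt0.
have s_last : last 1 s = g^-1.
  rewrite -nth_last s_size.
  have -> : (n.+1)`!.-1 = (n * n`! + n`!.-1)%N by rewrite factS mulSn; lia.
  rewrite block_translate ?ltn_predL // (@block_starts _ s g) //.
  apply: (mulgI g); rewrite mulgV -[RHS](@block_shift_order _ s g) //.
  by rewrite expgS /rmul mulgA.
split=> //; rewrite /append_letter; split.
- by rewrite size_rcons -cats1 take_size_cat.
- by rewrite last_rcons s_last /rmul mulgV; case: (s) s_gt0 s_start.
apply/subsetP => _ /imsetP[[i lti] _ ->] /=; rewrite size_rcons /= in lti.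
(* The only edge of the closed walk that is not a step of the listing is the
   closing one, which is labelled g. *)
rewrite !nth_rcons lti; have [lt_Si | ge_Si] := ltnP i.+1 (size s).
  exact: step_generators.
have eq_i : i = (size s).-1 by lia.
by rewrite eq_i prednK // eqxx nth_last /rmul mulgK.
Qed.
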